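(* Let $(U^n)_{n\in\mathbb{N}}$, $U^n=(u_1^n,\dots,u_M^n)^T\in\mathbb{C}^M$, be the solution of the implicit fully discrete scheme $$U^{n+1}-U^n=\mathbf{i}\frac{\tau}{h^2}AU^{n+\frac12}+\mathbf{i}\lambda\tau F(U^{n+\frac12})U^{n+\frac12}+\mathbf{i}Z(U^{n+\frac12})\delta_{n+1}\beta,$$ with the notation of the context. Let $p_j^n,q_j^n$ denote the real and imaginary parts of $u_j^n$, and set $v_j^n=\frac1h(p_j^n-p_{j-1}^n)$, $w_j^n=\frac1h(q_j^n-q_{j-1}^n)$. Then the scheme preserves the discrete multi-symplectic structure: for all $n\in\mathbb{N}$ and $j=1,\dots,M$, $$\begin{aligned}&\frac1\tau\left(dp_j^{n+1}\wedge dq_j^{n+1}-dp_j^{n}\wedge dq_j^{n}\right)-\frac1h\left(dp_j^{n+\frac12}\wedge dv_{j+1}^{n+\frac12}-dp_{j-1}^{n+\frac12}\wedge dv_j^{n+\frac12}\right)\\&-\frac1h\left(dq_j^{n+\frac12}\wedge dw_{j+1}^{n+\frac12}-dq_{j-1}^{n+\frac12}\wedge dw_j^{n+\frac12}\right)=0.\end{aligned}$$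
   Context: Notation. $M,K\in\mathbb{N}$ with $M\le K$; $h=\frac1{M+1}$; $x_j=jh$; $e_k(x)=\sqrt2\sin(k\pi x)$; $\eta_k>0$ with $\sum_{k=1}^\infty\eta_k<\infty$; $\lambda\in\{1,-1\}$; $\tau>0$ is the time step, $t_n=n\tau$. $\beta(t)=(\beta_1(t),\dots,\beta_K(t))^T$ is a vector of independent real Brownian motions and $\delta_{n+1}\beta=\beta(t_{n+1})-\beta(t_n)$. $A\in\mathbb{R}^{M\times M}$ is the tridiagonal matrix with $-2$ on the diagonal and $1$ on the sub- and super-diagonals. For $U=(u_1,\dots,u_M)^T\in\mathbb{C}^M$, $F(U)=\mathrm{diag}\{|u_1|^2,\dots,|u_M|^2\}$ and $Z(U)=\mathrm{diag}\{u_1,\dots,u_M\}E_{MK}\Lambda$, where $E_{MK}=(e_k(x_j))_{1\le j\le M,\,1\le k\le K}$ and $\Lambda=\mathrm{diag}\{\sqrt{\eta_1},\dots,\sqrt{\eta_K}\}$. A superscript $n+\frac12$ denotes the average of the values at levels $n$ and $n+1$, e.g. $U^{n+\frac12}=\frac12(U^{n+1}+U^n)$, $v_j^{n+\frac12}=\frac12(v_j^n+v_j^{n+1})$. Homogeneous Dirichlet boundary values are used: $u_0^n=u_{M+1}^n=0$. Here $d$ is the exterior differential in the phase space, i.e. with respect to the real and imaginary parts of the initial data, for a fixed realization of the noise; the identity holds $\mathbb{P}$-almost surely. *)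

(* Defs.v *)
From HB Require Import structures.
From mathcomp Require Import all_boot all_order all_algebra complex.
From mathcomp Require Import all_classical all_reals all_analysis.

Set Implicit Arguments.
Unset Strict Implicit.
Unset Printing Implicit Defensive.

Import Order.TTheory GRing.Theory Num.Theory.
Import numFieldNormedType.Exports.

Local Open Scope classical_set_scope.
Local Open Scope ring_scope.

Section Brownian.
Context (d : measure_display) (T : measurableType d) (R : realType).
Variable P : probability T R.

(* The product rule is only required for the full index set: in every use
   below the classes contain [setT], so all subfamilies are covered. *)
Definition mutually_independent (I : finType) (F : I -> set (set T)) : Prop :=
  forall A : I -> set T, (forall i, F i (A i)) ->
    P (\bigcap_i A i) = (\prod_i P (A i))%E.

Definition increment (B : R -> {RV P >-> R}) (s t : R) : T -> R :=
  fun w => B t w - B s w.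

(* A process indexed by [R], constrained only at times [t >= 0]. *)
Definition brownian_motion (B : R -> {RV P >-> R}) : Prop :=
  [/\ {ae P, forall w, B 0 w = 0},
      forall (m : nat) (t : nat -> R),
        0 <= t 0%N -> (forall i, t i <= t i.+1) ->
        mutually_independent (fun i : 'I_m =>
          [set increment B (t i) (t i.+1) @^-1` A | A in measurable]),
      forall s t : R, 0 <= s -> s < t ->
        forall A : set (measurableTypeR R), measurable A ->
          P (increment B s t @^-1` A)
          = normal_prob (0 : R) (Num.sqrt (t - s)) A
    & {ae P, forall w, {within `[0, +oo[, continuous (fun t : R => B t w)}} ].

Definition process_sigma_algebra (B : R -> {RV P >-> R}) : set (set T) :=
  <<s [set E | exists t : R, exists A : set (measurableTypeR R),
         [/\ 0 <= t, measurable A & E = B t @^-1` A] ] >>.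

Definition independent_brownian_motions (K : nat)
    (beta : 'I_K -> R -> {RV P >-> R}) : Prop :=
  (forall k, brownian_motion (beta k)) /\
  mutually_independent (fun k => process_sigma_algebra (beta k)).

End Brownian.

Section Scheme.
Context (R : realType).
Variables M K : nat.

Local Notation C := (R[i]%C).
Local Notation toC := (real_complex R).

(* Index conventions: [k : 'I_M] is the grid point j = k + 1, and [k : 'I_K]
   is the mode k + 1; only [eta k] with [k >= 1] is used. *)

Definition mesh : R := (M.+1%:R)^-1.

Definition grid (j : nat) : R := j%:R * mesh.

Definition eigenfun (k : nat) (x : R) : R :=
  Num.sqrt 2 * sin (k%:R * pi * x).

Definition laplacian_mx : 'M[R]_M :=
  \matrix_(i, j) (if i == j then - 2
                  else if (i.+1 == j :> nat) || (j.+1 == i :> nat) then 1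
                  else 0).

Definition E_mx : 'M[R]_(M, K) := \matrix_(j, k) eigenfun k.+1 (grid j.+1).

Definition Lambda_mx (eta : nat -> R) : 'M[R]_K :=
  diag_mx (\row_k Num.sqrt (eta k.+1)).

Definition F_mx (u : 'cV[C]_M) : 'M[C]_M := diag_mx (\row_j (`|u j 0| ^+ 2)).

Definition Z_mx (eta : nat -> R) (u : 'cV[C]_M) : 'M[C]_(M, K) :=
  diag_mx u^T *m map_mx toC E_mx *m map_mx toC (Lambda_mx eta).

Definition scheme_step (tau lambda : R) (eta : nat -> R) (dbeta : 'cV[R]_K)
    (u u' : 'cV[C]_M) : Prop :=
  let uh := 2^-1 *: (u' + u) in
  u' - u = ('i%C * toC (tau / mesh ^+ 2)) *: (map_mx toC laplacian_mx *m uh)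
         + ('i%C * toC (lambda * tau)) *: (F_mx uh *m uh)
         + 'i%C *: (Z_mx eta uh *m map_mx toC dbeta).

(* Real and imaginary parts of the initial data. *)
Definition phase : normedModType R := ('cV[R]_M * 'cV[R]_M)%type.

Definition complex_data (x : phase) : 'cV[C]_M :=
  \col_k (x.1 k 0 +i* x.2 k 0)%C.

(* [u_j] for 1 <= j <= M, and 0 at the boundary indices 0 and M + 1. *)
Definition node (u : 'cV[C]_M) (j : nat) : C :=
  if j is j'.+1 then (if insub j' is Some k then u k 0 else 0) else 0.

Section Components.
(* One realization: [U n x] is the level-n solution started from [x]. *)
Variable U : nat -> phase -> 'cV[C]_M.

Definition p_ (j n : nat) (x : phase) : R := complex.Re (node (U n x) j).

Definition q_ (j n : nat) (x : phase) : R := complex.Im (node (U n x) j).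

Definition v_ (j n : nat) (x : phase) : R :=
  mesh^-1 * (p_ j n x - p_ j.-1 n x).

Definition w_ (j n : nat) (x : phase) : R :=
  mesh^-1 * (q_ j n x - q_ j.-1 n x).

End Components.

Definition midlevel (f : nat -> phase -> R) (n : nat) (x : phase) : R :=
  2^-1 * (f n x + f n.+1 x).

(* [(df /\ dg)_x], with [(a /\ b)(xi, zeta) = a(xi) b(zeta) - a(zeta) b(xi)]. *)
Definition dwedge (f g : phase -> R) (x xi zeta : phase) : R :=
  'd (f : phase -> R^o) x xi * 'd (g : phase -> R^o) x zeta
  - 'd (f : phase -> R^o) x zeta * 'd (g : phase -> R^o) x xi.

End Scheme.

(* Main.v *)
(* For a fixed realization the scheme is a deterministic recursion. With
   P, Q the real and imaginary midpoint values, node j satisfies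
     p' - p = - (tau/h^2) (Q_{j-1} - 2 Q_j + Q_{j+1}) - r Q_j,
     q' - q =   (tau/h^2) (P_{j-1} - 2 P_j + P_{j+1}) + r P_j,
   with r = lambda tau (P_j^2 + Q_j^2) + c and the real noise c independent of
   the initial data. Since
     dp' /\ dq' - dp /\ dq = dP_j /\ d(q' - q) + d(p' - p) /\ dQ_j,
   all terms in r cancel: those with factor r because dP /\ dP = dQ /\ dQ = 0,
   those with dr because both equal 2 lambda tau P_j Q_j dP_j /\ dQ_j up to sign.
   The neighbour terms that remain are exactly the discrete divergence of
   dp /\ dv + dq /\ dw. *)
Require Import Defs.
From HB Require Import structures.
From mathcomp Require Import all_boot all_order all_algebra complex ring.
From mathcomp Require Import all_classical all_reals all_analysis.

Set Implicit Arguments.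
Unset Strict Implicit.
Unset Printing Implicit Defensive.

Import Order.TTheory GRing.Theory Num.Theory.
Import numFieldNormedType.Exports.

Local Open Scope classical_set_scope.
Local Open Scope ring_scope.

(** An index [m] outside the grid matches no term, so the sum gives the Dirichlet value 0; matrix
    rows next to the boundary then need no separate treatment. *)
Lemma sum_node (R : realType) (M : nat) (u : 'cV[R[i]%C]_M) (m : nat) :
  \sum_(k < M) (k == m :> nat)%:R * u k 0 = node u m.+1.
Proof.
rewrite /node; case: insubP => [k _ km | mM].
  rewrite (bigD1 k) //= -km eqxx mul1r big1 ?addr0 // => l lk.
  by rewrite (inj_eq val_inj) (negbTE lk) mul0r.
rewrite big1 // => l _; case: eqP => [lm|_]; last by rewrite mul0r.
by move: mM; rewrite -lm ltn_ord.
Qed.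

Lemma laplacian_node (R : realType) (M : nat) (u : 'cV[R[i]%C]_M) (k : 'I_M) :
  (map_mx (real_complex R) (laplacian_mx R M) *m u) k 0 =
  node u k - 2 * node u k.+1 + node u k.+2.
Proof.
(* [sum_node] reaches only positive node indices. The left neighbour is therefore selected by
   [l.+1 == k], which no [l] satisfies when [k = 0], in agreement with the zero boundary value. *)
have -> : node u k = \sum_(l < M) (l.+1 == k :> nat)%:R * u l 0.
  case: (nat_of_ord k) => [|m]; last by rewrite -sum_node.
  by rewrite big1 // => l _; rewrite mul0r.
rewrite -!sum_node mxE mulr_sumr -sumrB -big_split /=; apply: eq_bigr => l _.
rewrite !mxE -(inj_eq val_inj) /= [k == l :> nat]eq_sym [k.+1 == l :> nat]eq_sym.
have [->|lk] := eqVneq (l : nat) (k : nat).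
  rewrite [k.+1 == k :> nat]eqn_leq ltnn /= [k == k.+1 :> nat]eqn_leq ltnn andbF.
  by rewrite rmorphN rmorph_nat /=; ring.
have [->|lk1] := eqVneq (l : nat) k.+1.
  by rewrite (_ : k.+2 == k :> nat = false) ?rmorph1 /=; [ring | elim: (k : nat)].
by case: eqP => _; rewrite ?rmorph1 ?rmorph0 /=; ring.
Qed.

(** The noise enters through multiplication of the midpoint value by ['i c] with [c] real, so it has
    the same form as the cubic term and both merge into the single real factor [r]. *)
Lemma scheme_step_node (R : realType) (M K : nat) (tau lambda : R)
    (eta : nat -> R) (dbeta : 'cV[R]_K) (u u' : 'cV[R[i]%C]_M) (k : 'I_M) :
  let a := tau / mesh R M ^+ 2 in
  let c := (E_mx R M K *m Lambda_mx K eta *m dbeta) k 0 in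
  let P j := 2^-1 * (complex.Re (node u j) + complex.Re (node u' j)) in
  let Q j := 2^-1 * (complex.Im (node u j) + complex.Im (node u' j)) in
  let r := lambda * tau * (P k.+1 ^+ 2 + Q k.+1 ^+ 2) + c in
  scheme_step tau lambda eta dbeta u u' ->
  complex.Re (node u' k.+1) - complex.Re (node u k.+1) =
    - a * (Q k - 2 * Q k.+1 + Q k.+2) - r * Q k.+1 /\
  complex.Im (node u' k.+1) - complex.Im (node u k.+1) =
    a * (P k - 2 * P k.+1 + P k.+2) + r * P k.+1.
Proof.
move=> a c P Q r; rewrite /scheme_step => /matrixP /(_ k 0).
have half (z z' : R[i]%C) : 2^-1 * (z' + z) =
    Complex (2^-1 * (complex.Re z + complex.Re z'))
            (2^-1 * (complex.Im z + complex.Im z')).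
  rewrite -[2 : R[i]%C](rmorph_nat (real_complex R)) -fmorphV.
  by case: z z' => [x y] [x' y']; rewrite /= /real_complex_def; simpc;
    rewrite [x' + _]addrC [y' + _]addrC.
have nodeh j : node (2^-1 *: (u' + u)) j = Complex (P j) (Q j).
  rewrite -half; case: j => [|j] /=; first by rewrite addr0 mulr0.
  by case: insub => [l|]; rewrite ?mxE // addr0 mulr0.
have nodek (z : 'cV[R[i]%C]_M) : z k 0 = node z k.+1 by rewrite /node valK.
(* Reassociation isolates the real vector [N], which does not involve the solution; only the
   diagonal factor does. *)
rewrite /Z_mx -2!mulmxA -!map_mxM mulmxA /F_mx !mul_diag_mx.
set N := map_mx _ (_ *m _).
have EN : N k 0 = c%:C%C by rewrite mxE.
move: N EN (laplacian_node (2^-1 *: (u' + u)) k) => N EN.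
move: (_ *m (2^-1 *: _)) => L EL.
rewrite !mxE EN EL !nodeh !nodek half -/(P k.+1) -/(Q k.+1) -add_Re2_Im2.
rewrite -[2 : R[i]%C](rmorph_nat (real_complex R)) -/a.
case: (node u' k.+1) (node u k.+1) => [x' y'] [x y].
rewrite /= /real_complex_def /=; simpc => -[-> ->].
by split; rewrite /r; ring.
Qed.

(** Stated for abstract functions so that one differentiation serves both components: [q] with
    coefficients [a], [s], [c], and [p] with all three negated and [P], [Q] exchanged. *)
Lemma derive_step (R : realType) (V : normedModType R) (a s c : R)
    (f f' P Q Pm Pp : V -> R) (x v : V) (df df' dP dQ dPm dPp : R) :
  is_derive x v f df -> is_derive x v f' df' -> is_derive x v P dP ->
  is_derive x v Q dQ -> is_derive x v Pm dPm -> is_derive x v Pp dPp ->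
  (forall y, f' y - f y =
     a * (Pm y - 2 * P y + Pp y) + (s * (P y ^+ 2 + Q y ^+ 2) + c) * P y) ->
  df' - df = a * (dPm - 2 * dP + dPp) +
    s * (2 * P x * dP + 2 * Q x * dQ) * P x +
    (s * (P x ^+ 2 + Q x ^+ 2) + c) * dP.
Proof.
move=> Df Df' DP DQ DPm DPp E.
have fE : f' - f = a *: (Pm - 2 *: P + Pp) + (s *: (P * P + Q * Q) + cst c) * P.
  by apply/funext => y; rewrite -!expr2; exact: E.
have D1 := is_deriveB Df' Df.
have D2 := is_deriveD
  (is_deriveZ a (is_deriveD (is_deriveB DPm (is_deriveZ 2 DP)) DPp))
  (is_deriveM (is_deriveD (is_deriveZ s
     (is_deriveD (is_deriveM DP DP) (is_deriveM DQ DQ)))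
     (is_derive_cst c x v)) DP).
rewrite -fE in D2.
have -> : df' - df = 'D_v (f' - f) x.
  by rewrite (@derive_val _ _ _ _ _ _ _ D1).
rewrite (@derive_val _ _ _ _ _ _ _ D2).
(* Replaces the scalings on [R] by products, which [ring] recognizes. *)
transitivity (a * (dPm - 2 * dP + dPp) + ((s * (P x * P x + Q x * Q x) + c) * dP +
  P x * (s * ((P x * dP + P x * dP) + (Q x * dQ + Q x * dQ)) + 0))); first by [].
ring.
Qed.

Lemma is_derive_diff (R : realType) (V : normedModType R) (f : V -> R^o)
    (x v : V) :
  differentiable f x -> is_derive x v f ('d f x v).
Proof. by move=> df; rewrite -deriveE //; exact/derivableP/diff_derivable. Qed.

Lemma node_boundary (R : realType) (M : nat) (u : 'cV[R[i]%C]_M) :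
  node u M.+1 = 0.
Proof. by rewrite /node insubF ?ltnn. Qed.

(** With [b = 2^-1] this covers the midpoint averages, since [midlevel] unfolds to this form. *)
Lemma diffZD (R : realType) (V : normedModType R) (b : R)
    (f g : V -> R^o) (x : V) :
  differentiable f x -> differentiable g x ->
  differentiable (b *: (f + g)) x /\
  forall v, 'd (b *: (f + g)) x v = b * ('d f x v + 'd g x v) :> R.
Proof.
move=> df dg.
have dfg : differentiable (b *: (f + g)) x.
  exact/differentiableZ/differentiableD.
split=> [|v]; first exact: dfg.
apply: etrans (esym (deriveE v dfg)) _.
exact: (@derive_val _ _ _ _ _ _ _ (is_deriveZ b (is_deriveD
  (is_derive_diff v df) (is_derive_diff v dg)))).
Qed.

Lemma diffZB (R : realType) (V : normedModType R) (b : R)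
    (f g : V -> R^o) (x : V) :
  differentiable f x -> differentiable g x ->
  forall v, 'd (b *: (f - g)) x v = b * ('d f x v - 'd g x v) :> R.
Proof.
move=> df dg v.
have dfg : differentiable (b *: (f - g)) x.
  exact/differentiableZ/differentiableB.
apply: etrans (esym (deriveE v dfg)) _.
exact: (@derive_val _ _ _ _ _ _ _ (is_deriveZ b (is_deriveB
  (is_derive_diff v df) (is_derive_diff v dg)))).
Qed.

(** Averaging in time commutes with differencing in space, so the differentials of the midpoints of
    [v_] and [w_] reduce to those of [p_] and [q_]. *)
Lemma midlevel_divided_difference (R : realType) (M : nat) (b : R)
    (f g : nat -> phase R M -> R) (n : nat) :
  midlevel (fun n x => b * (f n x - g n x)) n =
  b *: (midlevel f n - midlevel g n).
Proof.
apply/funext => x; rewrite /midlevel.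
transitivity (b * (2^-1 * (f n x + f n.+1 x) - 2^-1 * (g n x + g n.+1 x))).
  by ring.
by [].
Qed.

(** Pure algebra at two fixed tangent vectors: the differentials enter only through their values at
    [xi] and [zeta], and [P], [Q] are the midpoint values at the base point. *)
Lemma wedge_balance (R : numFieldType) (T : Type) (tau h s c P Q : R)
    (p p' q q' Pm P0 Pp Qm Q0 Qp Vm Vp Wm Wp : T -> R) (xi zeta : T) :
  tau != 0 -> h != 0 ->
  let wedge (f g : T -> R) := f xi * g zeta - f zeta * g xi in
  (forall e, P0 e = 2^-1 * (p e + p' e)) ->
  (forall e, Q0 e = 2^-1 * (q e + q' e)) ->
  (forall e, Vm e = h^-1 * (P0 e - Pm e)) ->
  (forall e, Vp e = h^-1 * (Pp e - P0 e)) ->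
  (forall e, Wm e = h^-1 * (Q0 e - Qm e)) ->
  (forall e, Wp e = h^-1 * (Qp e - Q0 e)) ->
  (forall e, p' e - p e =
     - (tau / h ^+ 2) * (Qm e - 2 * Q0 e + Qp e) +
     - s * (2 * Q * Q0 e + 2 * P * P0 e) * Q +
     (- s * (Q ^+ 2 + P ^+ 2) - c) * Q0 e) ->
  (forall e, q' e - q e =
     tau / h ^+ 2 * (Pm e - 2 * P0 e + Pp e) +
     s * (2 * P * P0 e + 2 * Q * Q0 e) * P +
     (s * (P ^+ 2 + Q ^+ 2) + c) * P0 e) ->
  1 / tau * (wedge p' q' - wedge p q)
  - 1 / h * (wedge P0 Vp - wedge Pm Vm)
  - 1 / h * (wedge Q0 Wp - wedge Qm Wm) = 0.
Proof.
move=> tau0 h0 wedge EP EQ EVm EVp EWm EWp Ep Eq.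
(* Discrete product rule, exact because [P0] and [Q0] average the two time levels. *)
have -> : wedge p' q' - wedge p q =
    (P0 xi * (q' zeta - q zeta) - P0 zeta * (q' xi - q xi)) +
    ((p' xi - p xi) * Q0 zeta - (p' zeta - p zeta) * Q0 xi).
  by rewrite /wedge !EP !EQ; field.
by rewrite !Ep !Eq /wedge !EVm !EVp !EWm !EWp; field; rewrite h0.
Qed.

Theorem theorem3p2 (R : realType) (d : measure_display) (T : measurableType d)
    (P : probability T R) (M K : nat) (hMK : (M <= K)%N)
    (eta : nat -> R) (eta_gt0 : forall k, (0 < k)%N -> 0 < eta k)
    (eta_summable : cvgn (series (fun k => eta k.+1)))
    (lambda : R) (hlambda : lambda = 1 \/ lambda = - 1)
    (tau : R) (tau_gt0 : 0 < tau)
    (beta : 'I_K -> R -> {RV P >-> R})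
    (hbeta : independent_brownian_motions beta)
    (U : T -> nat -> phase R M -> 'cV[R[i]%C]_M)
    (hU : {ae P, forall w,
        (forall x, U w 0%N x = complex_data x) /\
        (forall n x,
          scheme_step tau lambda eta
            (\col_k increment (beta k) (n%:R * tau) (n.+1%:R * tau) w)
            (U w n x) (U w n.+1 x))}) :
  {ae P, forall w, forall (n j : nat) (x : phase R M),
    (1 <= j <= M)%N ->
    (forall m i, (n <= m <= n.+1)%N -> (1 <= i <= M)%N ->
       differentiable (p_ (U w) i m : phase R M -> R^o) x /\
       differentiable (q_ (U w) i m : phase R M -> R^o) x) ->
    let p := p_ (U w) in let q := q_ (U w) in
    let v := v_ (U w) in let vw := w_ (U w) in
    let h := mesh R M in
    forall xi zeta : phase R M,
      1 / tau * (dwedge (p j n.+1) (q j n.+1) x xi zeta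
                 - dwedge (p j n) (q j n) x xi zeta)
      - 1 / h * (dwedge (midlevel (p j) n) (midlevel (v j.+1) n) x xi zeta
                 - dwedge (midlevel (p j.-1) n) (midlevel (v j) n) x xi zeta)
      - 1 / h * (dwedge (midlevel (q j) n) (midlevel (vw j.+1) n) x xi zeta
                 - dwedge (midlevel (q j.-1) n) (midlevel (vw j) n) x xi zeta)
      = 0}.
Proof.
(* One almost sure event serves all [n], [j] and [x]; from here on the realization is fixed. *)
apply: filterS hU => w [_ step] n j x /andP[j1 jM] dpq xi zeta.
set p := p_ (U w) in dpq *; set q := q_ (U w) in dpq *.
set v := v_ (U w); set vw := w_ (U w); set h := mesh R M.
case: j j1 jM => // k _ kM.
(* Differentiability is assumed at interior nodes only; at the nodes 0 and [M.+1] the functions are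
   constantly 0. *)
have dp i m : (i <= M.+1)%N -> (n <= m <= n.+1)%N ->
    differentiable (p i m : phase R M -> R^o) x.
  rewrite leq_eqVlt => /predU1P[->|iM] nm.
    rewrite (_ : p _ m = cst 0) //; apply/funext => y.
    by rewrite /p /p_ node_boundary.
  case: i iM => [|i] iM; first exact: (differentiable_cst 0).
  by have [] := dpq m i.+1 nm iM.
have dq i m : (i <= M.+1)%N -> (n <= m <= n.+1)%N ->
    differentiable (q i m : phase R M -> R^o) x.
  rewrite leq_eqVlt => /predU1P[->|iM] nm.
    rewrite (_ : q _ m = cst 0) //; apply/funext => y.
    by rewrite /q /q_ node_boundary.
  case: i iM => [|i] iM; first exact: (differentiable_cst 0).
  by have [] := dpq m i.+1 nm iM.
have nn : (n <= n <= n.+1)%N by rewrite leqnn leqnSn.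
have nS : (n <= n.+1 <= n.+1)%N by rewrite leqnn leqnSn.
pose P' i := midlevel (p i) n; pose Q' i := midlevel (q i) n.
pose D (f : phase R M -> R) e : R := 'd (f : phase R M -> R^o) x e.
have DP i iM := diffZD 2^-1 (dp i n iM nn) (dp i n.+1 iM nS).
have DQ i iM := diffZD 2^-1 (dq i n iM nn) (dq i n.+1 iM nS).
have dP i iM : differentiable (P' i : _ -> R^o) x := (DP i iM).1.
have dQ i iM : differentiable (Q' i : _ -> R^o) x := (DQ i iM).1.
have k1 : (k.+1 <= M.+1)%N := ltnW kM.
have k0 : (k <= M.+1)%N := ltnW k1.
have Dv i e : (i < M.+1)%N ->
    D (midlevel (v i.+1) n) e = h^-1 * (D (P' i.+1) e - D (P' i) e).
  move=> iM; rewrite /D midlevel_divided_difference.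
  exact: diffZB (dP i.+1 iM) (dP i (ltnW iM)) e.
have Dw i e : (i < M.+1)%N ->
    D (midlevel (vw i.+1) n) e = h^-1 * (D (Q' i.+1) e - D (Q' i) e).
  move=> iM; rewrite /D midlevel_divided_difference.
  exact: diffZB (dQ i.+1 iM) (dQ i (ltnW iM)) e.
have stepk y := scheme_step_node (Ordinal kM) (step n y).
pose a := tau / h ^+ 2; pose s := lambda * tau.
(* This noise coefficient depends on [w], [n] and the node but not on the initial data, so it is a
   constant under differentiation. *)
pose c := (E_mx R M K *m Lambda_mx K eta *m
  \col_k increment (beta k) (n%:R * tau) (n.+1%:R * tau) w) (Ordinal kM) 0.
have Dp e : D (p k.+1 n.+1) e - D (p k.+1 n) e =
    - a * (D (Q' k) e - 2 * D (Q' k.+1) e + D (Q' k.+2) e) +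
    - s * (2 * Q' k.+1 x * D (Q' k.+1) e + 2 * P' k.+1 x * D (P' k.+1) e) *
      Q' k.+1 x +
    (- s * (Q' k.+1 x ^+ 2 + P' k.+1 x ^+ 2) - c) * D (Q' k.+1) e.
  apply: (derive_step
    (is_derive_diff e (dp _ _ k1 nn)) (is_derive_diff e (dp _ _ k1 nS))
    (is_derive_diff e (dQ _ k1)) (is_derive_diff e (dP _ k1))
    (is_derive_diff e (dQ _ k0)) (is_derive_diff e (dQ k.+2 kM))) => y.
  have [-> _] := stepk y.
  by rewrite -/c -/a -/s /P' /Q' /midlevel /p /q /p_ /q_ /=; ring.
have Dq e : D (q k.+1 n.+1) e - D (q k.+1 n) e =
    a * (D (P' k) e - 2 * D (P' k.+1) e + D (P' k.+2) e) +
    s * (2 * P' k.+1 x * D (P' k.+1) e + 2 * Q' k.+1 x * D (Q' k.+1) e) *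
      P' k.+1 x +
    (s * (P' k.+1 x ^+ 2 + Q' k.+1 x ^+ 2) + c) * D (P' k.+1) e.
  apply: (derive_step
    (is_derive_diff e (dq _ _ k1 nn)) (is_derive_diff e (dq _ _ k1 nS))
    (is_derive_diff e (dP _ k1)) (is_derive_diff e (dQ _ k1))
    (is_derive_diff e (dP _ k0)) (is_derive_diff e (dP k.+2 kM))) => y.
  by have [_ ->] := stepk y.
have h0 : h != 0 by rewrite invr_neq0 // pnatr_eq0.
exact: (wedge_balance xi zeta (lt0r_neq0 tau_gt0) h0 (DP _ k1).2 (DQ _ k1).2
  (fun e => Dv k e k1) (fun e => Dv k.+1 e kM)
  (fun e => Dw k e k1) (fun e => Dw k.+1 e kM) Dp Dq).
Qed.
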